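(* Let $\varphi(\bar x)$ be an $\mathrm{FOT}^{-}$-formula in the empty signature, with free variables among $\bar x=(x_1,\dots,x_k)$. Then there is an $\mathrm{FOT}^{-}$-formula $\psi(\bar x)$ which is a finite combination, using $\dot\sim$, $\land$ and $\vee_w$, of formulas of the forms $$x_i=x_j,\qquad \mathtt{C}(x_i),\qquad \sigma_{\ge n},$$ where $n\ge 1$ and $$\sigma_{\ge n}:=\exists^1 z_1\cdots\exists^1 z_n\bigwedge_{1\le i<j\le n}\dot\sim(z_i=z_j),$$ such that $\varphi(\bar x)\equiv_{\mathrm{FOT}}\psi(\bar x)$.
   Context: Structures $M$ have nonempty domain; the same letter denotes a structure and its domain. An assignment over $M$ is a map from a finite set of variables to $M$. A team over $M$ is a set of assignments with a common domain; the empty team is allowed. $s(a/x)$ is the assignment mapping $x$ to $a$ and otherwise agreeing with $s$; $X(a/x)=\{s(a/x):s\in X\}$. Formulas of $\mathrm{FOT}^{-}$: $\varphi::=\lambda\mid\dot\sim\varphi\mid(\varphi\land\varphi)\mid(\varphi\vee_w\varphi)\mid\exists^1x\,\varphi\mid\forall^1x\,\varphi$, where $\lambda$ is a first-order atomic formula (including equality atoms). In the empty signature the only atoms are equalities between variables. Satisfaction $M,X\models\varphi$ (the domain of $X$ contains the free variables of $\varphi$): - $M,X\models\lambda$ iff every $s\in X$ satisfies $\lambda$ in $M$ in the usual first-order sense; - $M,X\models\dot\sim\varphi$ iff $X=\emptyset$ or $M,X\not\models\varphi$; - $M,X\models\varphi\land\psi$ iff $M,X\models\varphi$ and $M,X\models\psi$;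 - $M,X\models\varphi\vee_w\psi$ iff $M,X\models\varphi$ or $M,X\models\psi$; - $M,X\models\exists^1x\,\varphi$ iff $M,X(a/x)\models\varphi$ for some $a\in M$; - $M,X\models\forall^1x\,\varphi$ iff $M,X(a/x)\models\varphi$ for all $a\in M$. $\mathtt{C}(x):=\exists^1z\,(z=x)$ with $z$ fresh. An empty conjunction is read as $\top:=\forall^1 z\,(z=z)$. We write $\varphi\equiv_{\mathrm{FOT}}\psi$ if for every model $M$ and every team $X$ over $M$ (with domain containing the free variables of both formulas), $M,X\models\varphi$ iff $M,X\models\psi$. *)

(* Defs.v *)
From mathcomp Require Import all_boot finmap.
From mathcomp Require Import classical_sets.

Set Implicit Arguments.
Unset Strict Implicit.
Unset Printing Implicit Defensive.

Local Open Scope fset_scope.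
Local Open Scope fmap_scope.

(* Formulas of FOT^- in the empty signature; the variables are the natural
   numbers. *)
Inductive formula : Type :=
| Eq (x y : nat)
| Neg (phi : formula)
| And (phi psi : formula)
| WOr (phi psi : formula)
| Ex1 (x : nat) (phi : formula)
| All1 (x : nat) (phi : formula).

Fixpoint fv (phi : formula) : {fset nat} :=
  match phi with
  | Eq x y => [fset x; y]
  | Neg phi => fv phi
  | And phi psi | WOr phi psi => fv phi `|` fv psi
  | Ex1 x phi | All1 x phi => fv phi `\ x
  end.

Definition assignment (M : Type) := {fmap nat -> M}.

(* The empty set of assignments is a team with domain D for every D. *)
Definition team (M : Type) (D : {fset nat}) (X : set (assignment M)) : Prop :=
  forall s, X s -> domf s = D.

Definition team_upd (M : Type) (X : set (assignment M)) (a : M) (x : nat) :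
    set (assignment M) :=
  ((fun s : assignment M => s.[x <- a]) @` X)%classic.

Fixpoint sat (M : Type) (X : set (assignment M)) (phi : formula) : Prop :=
  match phi with
  | Eq x y =>
      forall s, X s -> exists a : M, s.[? x] = Some a /\ s.[? y] = Some a
  | Neg phi => X = set0 \/ ~ sat X phi
  | And phi psi => sat X phi /\ sat X psi
  | WOr phi psi => sat X phi \/ sat X psi
  | Ex1 x phi => exists a : M, sat (team_upd X a x) phi
  | All1 x phi => forall a : M, sat (team_upd X a x) phi
  end.

(* A structure for the empty signature is just a nonempty domain. *)
Definition fot_equiv (phi psi : formula) : Prop :=
  forall M : Type, inhabited M ->
  forall (D : {fset nat}) (X : set (assignment M)),
    team D X -> fv phi `<=` D -> fv psi `<=` D ->
    (sat X phi <-> sat X psi).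

(* The fresh variable is x.+1. *)
Definition Const (x : nat) : formula := Ex1 x.+1 (Eq x.+1 x).

Definition Top : formula := All1 0 (Eq 0 0).

Fixpoint bigAnd (s : seq formula) : formula :=
  match s with
  | [::] => Top
  | [:: phi] => phi
  | phi :: s' => And phi (bigAnd s')
  end.

(* The variables z_1, ..., z_n are 1, ..., n; the sentence is closed, so they
   cannot interfere with other variables. *)
Definition sigma_ge (n : nat) : formula :=
  foldr Ex1
    (bigAnd [seq Neg (Eq i j) | i <- iota 1 n, j <- iota i.+1 (n - i)])
    (iota 1 n).

Inductive combination (k : nat) (x : k.-tuple nat) : formula -> Prop :=
| comb_Eq (i j : 'I_k) : combination x (Eq (tnth x i) (tnth x j))
| comb_Const (i : 'I_k) : combination x (Const (tnth x i))
| comb_sigma (n : nat) : 1 <= n -> combination x (sigma_ge n)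
| comb_Neg phi : combination x phi -> combination x (Neg phi)
| comb_And phi psi :
    combination x phi -> combination x psi -> combination x (And phi psi)
| comb_WOr phi psi :
    combination x phi -> combination x psi -> combination x (WOr phi psi).

(* Main.v *)
(** On the empty team every formula holds.  On a nonempty team [X] the truth of
    a formula depends only on which variables of interest coincide throughout
    [X], which of them are constant on [X], and the cardinality of the model up
    to a finite threshold: choosing a value [a] for a quantified variable means
    either choosing the value of a variable constant on [X] or choosing a fresh
    value, and the latter is possible exactly when the model has more elements
    than there are values of constant variables.  A property that depends only
    on the truth values of finitely many formulas is equivalent, on nonempty
    teams, to a boolean combination of them. *)
Require Import Defs.
From mathcomp Require Import all_boot finmap.
From mathcomp Require Import zify boolp classical_sets.

Set Implicit Arguments.
Unset Strict Implicit.
Unset Printing Implicit Defensive.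

Local Open Scope fset_scope.
Local Open Scope fmap_scope.

(** * Values of constant variables, and how updates affect them *)

Definition const_val M (X : set (assignment M)) (y : nat) (a : M) : Prop :=
  forall s, X s -> s.[? y] = Some a.

(** [{classic M}] gives an arbitrary type a classical equality test, so that [uniq] makes sense;
    infinite models are included. *)
Definition size_ge (M : Type) (n : nat) : Prop :=
  exists l : seq {classic M}, uniq l /\ size l = n.

Lemma sat_set0 M (phi : formula) : inhabited M -> sat (@set0 (assignment M)) phi.
Proof.
move=> [a0]; elim: phi => //=.
- by left.
- by left.
- by move=> x phi IH; exists a0; rewrite /team_upd image_set0.
- by move=> x phi IH a; rewrite /team_upd image_set0.
Qed.

Lemma sat_Neg M (X : set (assignment M)) phi :
  (X !=set0)%classic -> sat X (Neg phi) <-> ~ sat X phi.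
Proof. by move=> /set0P/eqP X0; split=> [[]|]//; right. Qed.

Lemma team_upd_nonempty M (X : set (assignment M)) a x :
  (X !=set0)%classic -> (team_upd X a x !=set0)%classic.
Proof. by move=> [s Xs]; exists s.[x <- a]; exists s. Qed.

Lemma const_val_inj M (X : set (assignment M)) y a b :
  (X !=set0)%classic -> const_val X y a -> const_val X y b -> a = b.
Proof. by move=> [s Xs] ya yb; have := yb s Xs; rewrite ya // => -[]. Qed.

Lemma const_val_upd M (X : set (assignment M)) a x :
  const_val (team_upd X a x) x a.
Proof. by move=> _ [s _ <-]; rewrite fnd_set eqxx. Qed.

Lemma const_val_updN M (X : set (assignment M)) a x y b :
  y != x -> const_val (team_upd X a x) y b <-> const_val X y b.
Proof.
move=> /negPf yx; split=> H s.
  by move=> Xs; have := H s.[x <- a]; rewrite fnd_set yx; apply; exists s.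
by move=> [t Xt <-]; rewrite fnd_set yx; apply: H.
Qed.

Lemma sat_Const M (X : set (assignment M)) y :
  sat X (Const y) <-> exists a, const_val X y a.
Proof.
have yS : y != y.+1 by rewrite neq_ltn ltnSn.
split=> -[a H]; exists a; last first.
  move=> s Xs; exists a; split; first exact: const_val_upd Xs.
  by move: s Xs; apply/const_val_updN.
apply/(@const_val_updN _ _ a y.+1 y) => // s Xs.
by have [b [<- ->]] := H _ Xs; rewrite (const_val_upd Xs).
Qed.

Lemma sat_Eq_sym M (X : set (assignment M)) y z :
  sat X (Eq y z) <-> sat X (Eq z y).
Proof. by split=> H s /H [a [? ?]]; exists a. Qed.

Lemma sat_Eq_const M (X : set (assignment M)) y z a :
  const_val X z a -> sat X (Eq y z) <-> const_val X y a.
Proof.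
move=> za; split=> [yz s Xs|ya s Xs]; last by exists a; rewrite ya // za.
by have [b [-> <-]] := yz _ Xs; apply: za.
Qed.

Lemma sat_Eq_updN M (X : set (assignment M)) a x y z :
  y != x -> z != x -> sat (team_upd X a x) (Eq y z) <-> sat X (Eq y z).
Proof.
move=> /negPf yx /negPf zx; split=> H s.
  by move=> Xs; have := H s.[x <- a]; rewrite !fnd_set yx zx; apply; exists s.
by move=> [t Xt <-]; rewrite !fnd_set yx zx; apply: H.
Qed.

(** * Back-and-forth between teams that agree *)

(** The back-and-forth invariant, relating teams over possibly different models: [V] holds the
    variables of interest and [N] bounds the cardinalities that are compared. *)
Record agree (V : {fset nat}) (N : nat) M (X : set (assignment M))
    M' (X' : set (assignment M')) : Prop := Agree {
  agree_Eq : forall y z, y \in V -> z \in V ->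
    sat X (Eq y z) <-> sat X' (Eq y z);
  agree_const : forall y, y \in V ->
    (exists a, const_val X y a) <-> (exists a, const_val X' y a);
  agree_size : forall n, n <= N -> size_ge M n <-> size_ge M' n }.

Lemma agree_sym V N M (X : set (assignment M)) M' (X' : set (assignment M')) :
  agree V N X X' -> agree V N X' X.
Proof.
by case=> e c s; split=> *; apply: iff_sym; [apply: e|apply: c|apply: s].
Qed.

Lemma agree_sub V W N N' M (X : set (assignment M)) M' (X' : set (assignment M')) :
  W `<=` V -> N' <= N -> agree V N X X' -> agree W N' X X'.
Proof.
move=> /fsubsetP WV NN [e c s]; split=> [y z yW zW|y yW|n nN].
- by apply: e; apply: WV.
- by apply: c; apply: WV.
- by apply: s; apply: leq_trans NN.
Qed.

(* If no value of [M'] is fresh, then [M'] is enumerated by the [m] values of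
   constant variables; transporting them to [M] and adding [a] yields [m.+1]
   elements of [M], against the agreement of sizes. *)
Lemma agree_pick V N M (X : set (assignment M)) M' (X' : set (assignment M')) a :
  (X !=set0)%classic -> (X' !=set0)%classic -> #|` V| < N -> agree V N X X' ->
  exists a', forall y, y \in V -> const_val X y a <-> const_val X' y a'.
Proof.
move=> X0 X'0 VN [eqV constV sizeV].
have [[y0 [y0V y0a]]|noa] := pselect (exists y, y \in V /\ const_val X y a).
  have [a' y0a'] : exists a', const_val X' y0 a' by apply/(constV _ y0V); exists a.
  exists a' => y yV.
  (* Having value [a] on [X] means coinciding with [y0], and agreement carries this over to [X']. *)
  apply: iff_trans (iff_trans (eqV _ _ yV y0V) (sat_Eq_const y y0a')).
  exact: iff_sym (sat_Eq_const y y0a).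
have [[a' fresh]|nofresh] :=
    pselect (exists a', forall y, y \in V -> ~ const_val X' y a').
  exists a' => y yV; split=> [ya|/(fresh y yV)//].
  by case: noa; exists y.
exfalso.
have cover (b : M') : exists y, y \in V /\ const_val X' y b.
  apply: contrapT => nb; apply: nofresh; exists b => y yV yb.
  by apply: nb; exists y.
have trans (b : M') : exists c : M, exists y,
    [/\ y \in V, const_val X' y b & const_val X y c].
  have [y [yV yb]] := cover b.
  by have [c yc] := (constV y yV).2 (ex_intro _ b yb); exists c, y.
have [g gP] := choice trans.
(* If two values have the same image, their variables coincide throughout [X], hence throughout
   [X'], so the values are equal. *)
have g_inj : injective (g : {classic M'} -> {classic M}).
  move=> b b' gbb'; have [y [yV yb yg]] := gP b; have [z [zV zb zg]] := gP b'.
  apply: (const_val_inj X'0 yb); apply/(sat_Eq_const y zb)/eqV => //.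
  by apply/(sat_Eq_const y zg); rewrite -[g b']gbb'.
have gNa (b : M') : g b <> a.
  by move=> gba; have [y [yV _ yg]] := gP b; apply: noa; exists y; rewrite -gba.
have [h hP] := choice cover.
pose val y : option {classic M'} :=
  if pselect (exists b, const_val X' y b) is left e then Some (projT1 (cid e))
  else None.
pose u := undup (pmap val V).
have uT (b : {classic M'}) : b \in u.
  rewrite mem_undup mem_pmap; apply/mapP; exists (h b); first exact: (hP b).1.
  rewrite /val; case: pselect => [e|[]]; last by exists b; exact: (hP b).2.
  by congr Some; apply: (const_val_inj X'0 (hP b).2); case: cid.
have su : size u <= #|` V|.
  by rewrite (leq_trans (size_undup _)) // size_pmap count_size.
(* The compared cardinality, [size u] plus one for [a], is at most [N] because the bound on the size
   of [V] is strict. *)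
have /sizeV [|l [lU ls]] : size_ge M (size u).+1.
- exists ((a : {classic M}) :: map (g : {classic M'} -> {classic M}) u).
  rewrite /= size_map map_inj_uniq // undup_uniq andbT; split=> //.
  by apply/mapP => -[b _ /esym/gNa].
- exact: leq_ltn_trans VN.
by have := uniq_leq_size lU (fun b _ => uT b); rewrite ls ltnn.
Qed.

(** After the update [x] is constant with value [a], so another variable coincides with [x] exactly
    when its constant value is [a]; this is what [agree_pick] preserves. Facts not involving [x] are
    unchanged. *)
Lemma agree_upd V N M (X : set (assignment M)) M' (X' : set (assignment M')) x a :
  (X !=set0)%classic -> (X' !=set0)%classic -> #|` V `\ x| < N ->
  agree (V `\ x) N X X' ->
  exists a', agree V N (team_upd X a x) (team_upd X' a' x).
Proof.
move=> X0 X'0 VN ag; have [a' aP] := agree_pick a X0 X'0 VN ag.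
case: ag => eqV constV sizeV; exists a'.
have mixed y : y \in V -> y != x ->
    sat (team_upd X a x) (Eq y x) <-> sat (team_upd X' a' x) (Eq y x).
  move=> yV yx.
  apply: iff_trans (sat_Eq_const y (@const_val_upd _ X a x)) _.
  apply: iff_trans (iff_sym (sat_Eq_const y (@const_val_upd _ X' a' x))).
  apply: iff_trans (const_val_updN _ _ _ yx) _.
  apply: iff_trans (iff_sym (const_val_updN _ _ _ yx)).
  by apply: aP; rewrite !inE yx.
split=> // [y z yV zV|y yV].
  have [->|yx] := eqVneq y x; have [->|zx] := eqVneq z x.
  - by split=> _; apply/sat_Eq_const; exact: const_val_upd.
  - apply: iff_trans (sat_Eq_sym _ _ _) _.
    by apply: iff_trans (mixed z zV zx) _; apply: sat_Eq_sym.
  - exact: mixed.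
  - apply: iff_trans (sat_Eq_updN _ _ yx zx) _.
    apply: iff_trans (iff_sym (sat_Eq_updN _ _ yx zx)).
    by apply: eqV; rewrite !inE ?yx ?zx.
have [->|yx] := eqVneq y x.
  by split=> _; [exists a'|exists a]; exact: const_val_upd.
have := constV y; rewrite !inE yx yV => /(_ isT) H.
by split=> -[b /const_val_updN-/(_ yx) yb];
  [have [c ?] := H.1 (ex_intro _ b yb)|have [c ?] := H.2 (ex_intro _ b yb)];
  exists c; apply/const_val_updN.
Qed.

(** At a quantifier the successor leaves room for one fresh value beyond those of the remaining free
    variables, giving the strict bound in [agree_upd]. *)
Fixpoint threshold (phi : formula) : nat :=
  match phi with
  | Eq _ _ => 0
  | Neg phi => threshold phi
  | And phi psi | WOr phi psi => maxn (threshold phi) (threshold psi)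
  | Ex1 x phi | All1 x phi => maxn (threshold phi) #|` fv phi `\ x|.+1
  end.

(** The induction ranges over all pairs of teams, since a quantifier updates both. A value chosen on
    one side is answered on the other by [agree_upd], applied to the agreement or to its symmetric
    version. *)
Lemma sat_agree phi N M (X : set (assignment M)) M' (X' : set (assignment M')) :
  (X !=set0)%classic -> (X' !=set0)%classic -> threshold phi <= N ->
  agree (fv phi) N X X' -> sat X phi <-> sat X' phi.
Proof.
elim: phi M X M' X' => [y z|phi IH|phi IH1 psi IH2|phi IH1 psi IH2|x phi IH|x phi IH]
  M X M' X' X0 X'0.
- by move=> _ /agree_Eq; apply; rewrite !inE eqxx ?orbT.
- move=> /= tN /(IH _ _ _ _ X0 X'0 tN) H.
  apply: iff_trans (sat_Neg phi X0) _.
  by apply: iff_trans (iff_sym (sat_Neg phi X'0)); split=> Hn /H.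
- rewrite /= geq_max => /andP[t1 t2] ag.
  have H1 := IH1 _ _ _ _ X0 X'0 t1 (agree_sub (fsubsetUl _ _) (leqnn _) ag).
  have H2 := IH2 _ _ _ _ X0 X'0 t2 (agree_sub (fsubsetUr _ _) (leqnn _) ag).
  by rewrite H1 H2.
- rewrite /= geq_max => /andP[t1 t2] ag.
  have H1 := IH1 _ _ _ _ X0 X'0 t1 (agree_sub (fsubsetUl _ _) (leqnn _) ag).
  have H2 := IH2 _ _ _ _ X0 X'0 t2 (agree_sub (fsubsetUr _ _) (leqnn _) ag).
  by rewrite H1 H2.
- rewrite /= geq_max => /andP[tN VN] ag; split=> -[a sa].
    have [a' /IH H] := agree_upd a X0 X'0 VN ag.
    by exists a'; apply/H => //; exact: team_upd_nonempty.
  have [a' /IH H] := agree_upd a X'0 X0 VN (agree_sym ag).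
  by exists a'; apply/H => //; exact: team_upd_nonempty.
- rewrite /= geq_max => /andP[tN VN] ag; split=> sa a.
    have [a' /IH H] := agree_upd a X'0 X0 VN (agree_sym ag).
    by apply/H => //; exact: team_upd_nonempty.
  have [a' /IH H] := agree_upd a X0 X'0 VN ag.
  by apply/H => //; exact: team_upd_nonempty.
Qed.

(** * The cardinality sentences *)

Lemma sat_bigAnd M (X : set (assignment M)) (I : eqType) (F : I -> formula) r :
  sat X (bigAnd (map F r)) <-> {in r, forall i, sat X (F i)}.
Proof.
elim: r => [|i [|j r] IH].
- by split=> // _ a s Xs; exists a; rewrite (const_val_upd Xs).
- by split=> [Fi _ /[!inE]/eqP-> //|]; apply; exact: mem_head.
- change (sat X (F i) /\ sat X (bigAnd (map F (j :: r))) <->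
    {in i :: j :: r, forall i, sat X (F i)}).
  rewrite IH.
  split=> [[Fi Fr] k /[!inE]/predU1P[-> //|]|H]; first exact: Fr.
  by split=> [|k kr]; apply: H; rewrite in_cons ?eqxx ?kr ?orbT.
Qed.

(** The team reached once a block of quantifiers over [m], [m.+1], ... has picked the entries of
    [l]. *)
Fixpoint team_upds M (X : set (assignment M)) (m : nat) (l : seq M) :=
  if l is a :: l' then team_upds (team_upd X a m) m.+1 l' else X.

Lemma team_upds_nonempty M (X : set (assignment M)) m l :
  (X !=set0)%classic -> (team_upds X m l !=set0)%classic.
Proof. by elim: l X m => //= a l IH X m X0; exact/IH/team_upd_nonempty. Qed.

Lemma const_val_upds_lt M (X : set (assignment M)) m l i a :
  i < m -> const_val X i a -> const_val (team_upds X m l) i a.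
Proof.
elim: l X m => //= b l IH X m im ia; apply: IH; first exact: ltnW.
by apply/const_val_updN; rewrite // neq_ltn im.
Qed.

Lemma const_val_upds M (X : set (assignment M)) m l a0 i :
  i < size l -> const_val (team_upds X m l) (m + i) (nth a0 l i).
Proof.
elim: l X m i => //= b l IH X m [|i] il.
  by rewrite addn0; apply: const_val_upds_lt => //; exact: const_val_upd.
by rewrite addnS -addSn; apply: IH.
Qed.

Lemma sat_Ex1s M (X : set (assignment M)) m n phi :
  sat X (foldr Ex1 phi (iota m n)) <->
  exists l : seq M, size l = n /\ sat (team_upds X m l) phi.
Proof.
elim: n X m => [|n IH] X m /=.
  by split=> [H|[[|a l] [//]]]; first by exists [::].
split=> [[a /IH [l [sl H]]]|[l [sl H]]].
  by exists (a :: l); rewrite /= sl.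
case: l sl H => // a l [sl] H.
by exists a; apply/IH; exists l.
Qed.

(** The witnesses form a list whose entries become constant values of the bound variables; on a
    nonempty team, the negated equalities then say that the entries are pairwise distinct. *)
Lemma sat_sigma_ge M (X : set (assignment M)) n :
  (X !=set0)%classic -> sat X (sigma_ge n) <-> size_ge M n.
Proof.
move=> X0.
have body (l : seq M) : size l = n ->
    sat (team_upds X 1 l)
      (bigAnd [seq Neg (Eq i j) | i <- iota 1 n, j <- iota i.+1 (n - i)]) <->
    uniq (l : seq {classic M}).
  (* Indexing the conjuncts by pairs turns the double comprehension into a [map], as [sat_bigAnd]
     expects. *)
  move=> sl; rewrite -(map_allpairs (fun p => Neg (Eq p.1 p.2)) pair).
  have Y0 := team_upds_nonempty 1 l X0.
  have val a0 i : i < n -> const_val (team_upds X 1 l) i.+1 (nth a0 l i).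
    by rewrite -sl; exact: (@const_val_upds M X 1 l a0 i).
  apply: iff_trans (sat_bigAnd _ _ _) _; split=> [H|lU [i j]].
    (* The head of a nonempty list serves as the default value for [nth]. *)
    case: l => [//|a0 l'] in sl val Y0 H *; set l := a0 :: l' in sl val Y0 H *.
    apply/(uniqP (a0 : {classic M})).
    have key i j : i < j -> j < n -> nth a0 l i <> nth a0 l j.
      move=> ij jn eq_ij.
      have /H/(sat_Neg _ Y0) : (i.+1, j.+1) \in
          [seq (i, j) | i <- iota 1 n, j <- iota i.+1 (n - i)].
        apply/allpairsPdep; exists i.+1, j.+1.
        by rewrite !mem_iota; split=> //; lia.
      apply.
      apply/(sat_Eq_const _ (val a0 _ jn)); rewrite -eq_ij.
      by apply: val; apply: ltn_trans jn.
    move=> i j; rewrite !inE sl => il jl eq_ij.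
    by case: (ltngtP i j) => // [ij|ji]; [case: (key _ _ ij jl)|case: (key _ _ ji il)].
  case/allpairsPdep=> -[|i'] [[|j'] []]; rewrite !mem_iota; try lia.
  move=> i1 j1 [-> ->]; apply/(sat_Neg _ Y0).
  have i'n : i' < n by lia.
  have j'n : j' < n by lia.
  case: l => [|a0 l'] in sl lU val Y0 *; first by move: i'n; rewrite -sl.
  move=> /(sat_Eq_const _ (val a0 _ j'n))/(const_val_inj Y0 (val a0 _ i'n)).
  have := uniqP (a0 : {classic M}) lU i' j'; rewrite !inE sl => inj.
  by move=> /(inj i'n j'n); lia.
apply: iff_trans (sat_Ex1s _ _ _ _) _.
by split=> -[l [H1 H2]]; exists l; split=> //; apply/body.
Qed.

(** * Expressing invariant properties by boolean combinations *)

Definition same_on (I : eqType) (F : I -> formula) (r : seq I)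
    M (X : set (assignment M)) M' (X' : set (assignment M')) : Prop :=
  {in r, forall i, sat X (F i) <-> sat X' (F i)}.

(** Induction on [r]: once the truth value of [F i] is fixed, [P] depends only on the rest of the
    list. The two formulas obtained for the two truth values are joined by a case distinction on
    [F i]. *)
Lemma boolean_combination k (x : k.-tuple nat) (I : eqType)
    (F : I -> formula) (r : seq I) (P : forall M, set (assignment M) -> Prop) :
  (forall i, combination x (F i)) ->
  (forall M (X : set (assignment M)) M' (X' : set (assignment M')),
    (X !=set0)%classic -> (X' !=set0)%classic -> same_on F r X X' ->
    P M X -> P M' X') ->
  exists psi, combination x psi /\
    forall M (X : set (assignment M)), (X !=set0)%classic ->
      sat X psi <-> P M X.
Proof.
move=> combF.
elim: r P => [|i r IH] P inv.
  have csigma : combination x (sigma_ge 1) by apply: comb_sigma.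
  (* A tautology that is a legitimate combination even for [k = 0]; [Top] itself is not one of the
     permitted forms. *)
  pose T := WOr (sigma_ge 1) (Neg (sigma_ge 1)).
  have cT : combination x T by apply: comb_WOr => //; apply: comb_Neg.
  have satT M (X : set (assignment M)) : (X !=set0)%classic -> sat X T.
    move=> X0; have [|ns] := pselect (sat X (sigma_ge 1)); first by left.
    by right; apply/sat_Neg.
  (* With no formulas left to compare, [P] holds on all nonempty teams or on none. *)
  have [[M [X [X0 PX]]]|nP] := pselect (exists M X, (X !=set0)%classic /\ P M X).
    exists T; split=> // M' X' X'0; split=> [_|_]; last exact: satT.
    by apply: (inv _ _ _ _ X0 X'0 _ PX).
  exists (Neg T); split=> [|M X X0]; first exact: comb_Neg.
  split=> [/sat_Neg-/(_ X0)/(_ (satT _ _ X0)) //|PX].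
  by case: nP; exists M, X.
(* [P] no longer depends on [F i] once it is read off some other team that
   agrees on [r] and gives [F i] the truth value [Q]. *)
pose cond (Q : Prop) M (X : set (assignment M)) :=
  exists M' (X' : set (assignment M')),
    [/\ (X' !=set0)%classic, same_on F r X X', sat X' (F i) <-> Q & P M' X'].
have cond_inv Q M (X : set (assignment M)) M' (X' : set (assignment M')) :
    (X !=set0)%classic -> (X' !=set0)%classic -> same_on F r X X' ->
    cond Q M X -> cond Q M' X'.
  move=> X0 X'0 XX' [M1 [X1 [X10 XX1 FiQ PX1]]]; exists M1, X1; split=> //.
  by move=> j jr; apply: iff_trans (iff_sym (XX' j jr)) (XX1 j jr).
have condP Q M (X : set (assignment M)) :
    (X !=set0)%classic -> sat X (F i) <-> Q -> cond Q M X <-> P M X.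
  move=> X0 FiQ; split=> [[M1 [X1 [X10 XX1 Fi1Q]]]|PX]; last first.
    by exists M, X; split=> // j _.
  apply: inv => // j /[!inE]/predU1P[->|jr].
    exact: iff_trans Fi1Q (iff_sym FiQ).
  exact: iff_sym (XX1 j jr).
have [psi1 [c1 psi1P]] := IH (cond True) (@cond_inv True).
have [psi0 [c0 psi0P]] := IH (cond False) (@cond_inv False).
exists (WOr (And (F i) psi1) (And (Neg (F i)) psi0)); split.
  by apply: comb_WOr; apply: comb_And => //; apply: comb_Neg.
move=> M X X0.
have [FiX|nFiX] := pselect (sat X (F i)).
  have FiT : sat X (F i) <-> True by [].
  have := psi1P M X X0; have := condP _ M X X0 FiT => <- H.
  split=> [[[_ /H//]|[/(sat_Neg _ X0)//]]|/H ?]; by left.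
have FiF : sat X (F i) <-> False by split.
have := psi0P M X X0; have := condP _ M X X0 FiF => <- H.
split=> [[[]//|[_ /H//]]|/H ?]; right; split=> //; exact/sat_Neg.
Qed.

(** * Free variables of combinations, and the normal form *)

Lemma fv_bigAnd (V : {pred nat}) (I : eqType) (F : I -> formula) r :
  {in r, forall i, {subset fv (F i) <= V}} ->
  {subset fv (bigAnd (map F r)) <= V}.
Proof.
elim: r => [|i [|j r] IH] H y.
- by rewrite /= !inE; case: eqVneq.
- by apply: H; rewrite mem_head.
- have -> : fv (bigAnd (map F [:: i, j & r])) =
      fv (F i) `|` fv (bigAnd (map F (j :: r))) by [].
  case/fsetUP; first by apply: H; rewrite mem_head.
  by apply: IH => l lr; apply: H; rewrite in_cons lr orbT.
Qed.

Lemma fv_Ex1s phi vs :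
  {subset fv phi <= vs} -> fv (foldr Ex1 phi vs) = fset0.
Proof.
move=> sub; apply/fsetP => y; rewrite in_fset0; apply/negbTE.
have fvE : y \in fv (foldr Ex1 phi vs) -> (y \in fv phi) && (y \notin vs).
  elim: vs {sub} => [->//|v vs IH] /=.
  by rewrite !inE => /andP[yv /IH/andP[-> yvs]]; rewrite negb_or yv.
by apply/negP => /fvE/andP[/sub->].
Qed.

Lemma fv_sigma_ge n : fv (sigma_ge n) = fset0.
Proof.
apply: fv_Ex1s; rewrite -(map_allpairs (fun p => Neg (Eq p.1 p.2)) pair).
apply: fv_bigAnd => p /allpairsPdep[i [j []]]; rewrite !mem_iota => i1 j1 -> y.
by rewrite /= !inE mem_iota; lia.
Qed.

Lemma fv_combination k (x : k.-tuple nat) psi :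
  combination x psi -> {subset fv psi <= x}.
Proof.
elim=> {psi} [i j|i|n _|//|phi psi _ IH1 _ IH2|phi psi _ IH1 _ IH2] y.
- by rewrite /= !inE => /orP[]/eqP->; apply: mem_tnth.
- by rewrite /= !inE => /andP[/negPf-> /eqP->]; apply: mem_tnth.
- by rewrite fv_sigma_ge.
- by rewrite inE => /orP[/IH1|/IH2].
- by rewrite inE => /orP[/IH1|/IH2].
Qed.

Theorem proposition3p5 (k : nat) (x : k.-tuple nat) (phi : formula)
    (fv_phi : {subset fv phi <= x}) :
  exists psi : formula,
    combination x psi /\ {subset fv psi <= x} /\ fot_equiv phi psi.
Proof.
(* A finite index type for the relevant basic formulas; [n.+1] runs over the cardinalities from 1 up
   to the threshold of [phi]. *)
pose F (a : 'I_k * 'I_k + 'I_k + 'I_(threshold phi)) := match a with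
  | inl (inl (i, j)) => Eq (tnth x i) (tnth x j)
  | inl (inr i) => Const (tnth x i)
  | inr n => sigma_ge n.+1
  end.
have combF a : combination x (F a).
  case: a => [[[i j]|i]|n]; [exact: comb_Eq|exact: comb_Const|].
  exact: comb_sigma.
have [M X M' X' X0 X'0 same satX|psi [cpsi psiP]] :=
    @boolean_combination _ x _ F (enum predT) (fun M X => sat X phi) combF.
  have {}same a : sat X (F a) <-> sat X' (F a) by apply: same; rewrite mem_enum.
  have fvP y : y \in fv phi -> exists i, y = tnth x i.
    by move=> /fv_phi/tnthP.
  apply: (iffLR (sat_agree X0 X'0 (leqnn _) _)) satX.
  split=> [y z /fvP[i ->] /fvP[j ->]|y /fvP[i ->]|[|n] nN].
  - exact: (same (inl (inl (i, j)))).
  - apply: iff_trans (iff_sym (sat_Const X _)) _.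
    by apply: iff_trans (sat_Const X' _); apply: (same (inl (inr i))).
  (* Cardinality 0 has no formula in [F]; every model meets it through the empty list. *)
  - by split=> _; exists [::].
  - apply: iff_trans (iff_sym (sat_sigma_ge _ X0)) _.
    apply: iff_trans (sat_sigma_ge _ X'0).
    exact: (same (inr (Ordinal nN))).
exists psi; split=> //; split; first exact: fv_combination.
(* The empty team satisfies both formulas, so only nonempty teams need [psiP]. *)
move=> M M0 D X _ _ _; have [->|/set0P X0] := eqVneq X set0.
  by split=> _; exact: sat_set0.
exact: iff_sym (psiP M X X0).
Qed.
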